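(* Let $M$ be a smooth connected manifold with a linear connection $\nabla$ (a connection on $TM$) with torsion $T$ and curvature $\mathfrak{R}$. For every $1$-form $\theta\in\bigwedge^1(M)$ and every vector field $Z\in\mathfrak{X}(M)$: (I) $dT_\theta=d\Xi_\theta=\mathfrak{R}_\theta+\nabla\theta\wedge T$; (II) $d\mathfrak{R}_{\theta,Z}=d\Psi_{\theta,Z}=\nabla\theta\wedge\mathfrak{R}_Z+\mathfrak{R}_\theta\wedge\nabla Z$. Here the right-hand sides are the $3$-forms given, for $X,Y,W\in\mathfrak{X}(M)$, by $$\mathfrak{R}_\theta(X,Y,W)=\sum_{\mathrm{cyclic}\ XYW}\theta(\mathfrak{R}(X,Y)W),\qquad (\nabla\theta\wedge T)(X,Y,W)=\sum_{\mathrm{cyclic}\ XYW}(\nabla_X\theta)(T(Y,W)),$$ $$(\nabla\theta\wedge\mathfrak{R}_Z)(X,Y,W)=\sum_{\mathrm{cyclic}\ XYW}(\nabla_X\theta)(\mathfrak{R}(Y,W)Z),\qquad (\mathfrak{R}_\theta\wedge\nabla Z)(X,Y,W)=\sum_{\mathrm{cyclic}\ XYW}\theta(\mathfrak{R}(Y,W)\nabla_XZ).$$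
   Context: $\mathfrak{X}(M)$ denotes smooth vector fields on $M$. Torsion and curvature: $T(X,Y)=\nabla_XY-\nabla_YX-[X,Y]$, $\mathfrak{R}(X,Y)Z=\nabla_X\nabla_YZ-\nabla_Y\nabla_XZ-\nabla_{[X,Y]}Z$. The connection acts on $1$-forms by $(\nabla_X\theta)(Y)=X(\theta(Y))-\theta(\nabla_XY)$. The $2$-forms are $T_\theta(X,Y)=\theta(T(X,Y))$, $\Xi_\theta(X,Y)=(\nabla_Y\theta)(X)-(\nabla_X\theta)(Y)$, $\mathfrak{R}_{\theta,Z}(X,Y)=\theta(\mathfrak{R}(X,Y)Z)$, $\Psi_{\theta,Z}(X,Y)=(\nabla_Y\theta)(\nabla_XZ)-(\nabla_X\theta)(\nabla_YZ)$. $\sum_{\mathrm{cyclic}\ XYW}$ is the sum over the three cyclic permutations of $(X,Y,W)$. The exterior derivative of a $2$-form $\beta$ is normalized by $d\beta(X,Y,W)=\sum_{\mathrm{cyclic}\ XYW}\big(X(\beta(Y,W))-\beta([X,Y],W)\big)$. *)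

(* Defs.v *)
From HB Require Import structures.
From mathcomp Require Import all_boot all_order all_algebra.
From mathcomp Require Import all_classical all_reals all_analysis.
From mathcomp Require Import ring.

Set Implicit Arguments.
Unset Strict Implicit.
Unset Printing Implicit Defensive.

Import Order.TTheory GRing.Theory Num.Theory.
Import numFieldNormedType.Exports.

Local Open Scope classical_set_scope.
Local Open Scope ring_scope.

Section smooth_on.
Variables (R : realType) (n : nat).
Implicit Types (U : set 'rV[R]_n) (f g : 'rV[R]_n -> R).

(* For [U] open: the partial derivatives of order at most [k] exist and are
   continuous on [U]. The values of [f] outside [U] are irrelevant. *)
Fixpoint Ck_on (k : nat) U f : Prop :=
  {in U, continuous f} /\
  if k is k'.+1 then
    forall i : 'I_n,
      {in U, forall x, derivable f x (delta_mx 0 i)} /\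
      Ck_on k' U ('D_(delta_mx 0 i) f)
  else True.

Definition smooth_on U f : Prop := forall k, Ck_on k U f.

Lemma Ck_on_continuous k U f : Ck_on k U f -> {in U, continuous f}.
Proof. by case: k => [|k] []. Qed.

Lemma Ck_onW k U f : Ck_on k.+1 U f -> Ck_on k U f.
Proof.
elim: k f => [|k IH] f; first by move=> [fc _].
move=> [fc fd]; split=> // i; have [di ci] := fd i; split=> //.
exact: IH.
Qed.

Lemma in_near_eq U f g x :
  open U -> {in U, f =1 g} -> x \in U -> {near x, f =1 g}.
Proof.
move=> oU fg Ux; have /open_nbhs_nbhs := conj oU (set_mem Ux).
by apply: filterS => y Uy; apply: fg; exact: mem_set.
Qed.

Lemma eq_Ck_on k U f g :
  open U -> {in U, f =1 g} -> Ck_on k U f -> Ck_on k U g.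
Proof.
move=> oU.
have eqc (h1 h2 : 'rV[R]_n -> R) : {in U, h1 =1 h2} ->
    {in U, continuous h1} -> {in U, continuous h2}.
  move=> h12 h1c x Ux; rewrite /continuous_at -(h12 x Ux).
  apply: cvg_trans (h1c x Ux); apply: (@near_eq_cvg _ _ (nbhs x)).
  exact: in_near_eq oU h12 Ux.
elim: k f g => [|k IH] f g fg [fc fd]; split=> //; try exact: eqc fg fc.
move=> i; have [di ci] := fd i; split=> [x Ux|].
  by apply: near_eq_derivable (di x Ux); exact: in_near_eq oU fg Ux.
by apply: IH ci => x Ux; apply: near_eq_derive; exact: in_near_eq oU fg Ux.
Qed.

Lemma Ck_on_cst k U c : open U -> Ck_on k U (cst c).
Proof.
move=> oU; elim: k c => [|k IH] c; split=> //;
  try by move=> x _; exact: cst_continuous.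
move=> i; split=> [x _|]; first exact: derivable_cst.
by apply: (eq_Ck_on oU _ (IH 0)) => x _; rewrite derive_cst.
Qed.

Lemma Ck_onD k U f g : open U ->
  Ck_on k U f -> Ck_on k U g -> Ck_on k U (f + g).
Proof.
move=> oU; elim: k f g => [|k IH] f g [fc fd] [gc gd]; split=> //;
  try by move=> x Ux; apply: continuousD; [exact: fc|exact: gc].
move=> i; have [dfi cfi] := fd i; have [dgi cgi] := gd i.
split=> [x Ux|]; first by apply: derivableD; [exact: dfi|exact: dgi].
apply: (eq_Ck_on oU _ (IH _ _ cfi cgi)) => x Ux.
by rewrite deriveD; [|exact: dfi|exact: dgi].
Qed.

Lemma Ck_onM k U f g : open U ->
  Ck_on k U f -> Ck_on k U g -> Ck_on k U (f * g).
Proof.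
move=> oU; elim: k f g => [|k IH] f g [fc fd] [gc gd]; split=> //;
  try by move=> x Ux; apply: continuousM; [exact: fc|exact: gc].
move=> i; have [dfi cfi] := fd i; have [dgi cgi] := gd i.
split=> [x Ux|]; first by apply: derivableM; [exact: dfi|exact: dgi].
have fk : Ck_on k U f by apply: Ck_onW; split.
have gk : Ck_on k U g by apply: Ck_onW; split.
apply: (eq_Ck_on oU _ (Ck_onD oU (IH _ _ fk cgi) (IH _ _ gk cfi))) => x Ux.
by rewrite deriveM; [|exact: dfi|exact: dgi].
Qed.
End smooth_on.

(* A homeomorphism from an open subset of [M] onto an open subset of R^n; the
   values of [chart_map] off [chart_dom] and of [chart_inv] off [chart_img] are
   irrelevant. *)
Record chart (R : realType) (n : nat) (M : topologicalType) := Chart {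
  chart_dom : set M;
  chart_map :> M -> 'rV[R]_n;
  chart_inv : 'rV[R]_n -> M;
  chart_dom_open : open chart_dom;
  chart_img_open : open (chart_map @` chart_dom);
  chart_mapK : {in chart_dom, cancel chart_map chart_inv};
  chart_map_continuous : {in chart_dom, continuous chart_map};
  chart_inv_continuous : {in chart_map @` chart_dom, continuous chart_inv}
}.

Arguments chart_dom_open {R n M} c.
Arguments chart_img_open {R n M} c.

Definition chart_img (R : realType) (n : nat) (M : topologicalType)
  (c : chart R n M) : set 'rV[R]_n := c @` chart_dom c.

Definition smooth_transition (R : realType) (n : nat) (M : topologicalType)
    (c d : chart R n M) : Prop :=
  forall i : 'I_n, smooth_on (c @` (chart_dom c `&` chart_dom d))
    (fun x => d (chart_inv c x) 0 i).

HB.mixin Record isSmoothManifold (R : realType) (n : nat) M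
    of Topological M := {
  manifold_hausdorff : hausdorff_space M;
  manifold_second_countable : @second_countable M;
  atlas : set (chart R n M);
  atlas_cover : forall p : M, exists2 c, atlas c & chart_dom c p;
  atlas_compatible : forall c d, atlas c -> atlas d -> smooth_transition c d
}.

#[short(type="smoothManifoldType")]
HB.structure Definition SmoothManifold (R : realType) (n : nat) :=
  { M of isSmoothManifold R n M & Topological M }.

Section smooth_functions.
Variables (R : realType) (n : nat) (M : smoothManifoldType R n).

Definition smooth_fun (f : M -> R) : Prop :=
  forall c : chart R n M, atlas c -> smooth_on (chart_img c) (f \o chart_inv c).

Definition smooth_pred : {pred M -> R} := fun f => `[< smooth_fun f >].

Lemma smooth_predP f : reflect (smooth_fun f) (f \in smooth_pred).
Proof. exact: asboolP. Qed.

Lemma smooth_cst (a : R) : smooth_fun (cst a).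
Proof. by move=> c _ k; exact: (Ck_on_cst k a (chart_img_open c)). Qed.

Lemma smoothD f g : smooth_fun f -> smooth_fun g -> smooth_fun (f + g).
Proof.
move=> sf sg c ac k.
exact: (Ck_onD (f := f \o chart_inv c) (g := g \o chart_inv c)
  (chart_img_open c) (sf c ac k) (sg c ac k)).
Qed.

Lemma smoothM f g : smooth_fun f -> smooth_fun g -> smooth_fun (f * g).
Proof.
move=> sf sg c ac k.
exact: (Ck_onM (f := f \o chart_inv c) (g := g \o chart_inv c)
  (chart_img_open c) (sf c ac k) (sg c ac k)).
Qed.

Lemma smoothZ (a : R) f : smooth_fun f -> smooth_fun (a *: f).
Proof. by move=> sf; exact: smoothM (smooth_cst a) sf. Qed.

Lemma smoothN f : smooth_fun f -> smooth_fun (- f).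
Proof. by move=> sf; rewrite -scaleN1r; exact: smoothZ. Qed.

Lemma smooth_subring_closed : subring_closed smooth_pred.
Proof.
split=> [|f g|f g]; first by apply/smooth_predP; exact: smooth_cst.
- move=> /smooth_predP sf /smooth_predP sg; apply/smooth_predP.
  by apply: smoothD => //; exact: smoothN.
- move=> /smooth_predP sf /smooth_predP sg; apply/smooth_predP.
  exact: smoothM.
Qed.
HB.instance Definition _ :=
  GRing.isSubringClosed.Build (M -> R) smooth_pred smooth_subring_closed.

Lemma smooth_scaler_closed : GRing.scaler_closed smooth_pred.
Proof.
by move=> a f /smooth_predP sf; apply/smooth_predP; exact: smoothZ.
Qed.
HB.instance Definition _ :=
  GRing.isScaleClosed.Build R (M -> R) smooth_pred smooth_scaler_closed.

Record cinf := Cinf { cinf_fun :> M -> R; cinf_mem : cinf_fun \in smooth_pred }.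

HB.instance Definition _ := [isSub for cinf_fun].
HB.instance Definition _ := [Choice of cinf by <:].
HB.instance Definition _ :=
  GRing.SubChoice_isSubComPzRing.Build _ _ cinf smooth_subring_closed.
HB.instance Definition _ := [SubZmodule_isSubLmodule of cinf by <:].
End smooth_functions.

Section tangent_vectors.
Variables (R : realType) (n : nat) (M : smoothManifoldType R n).

Lemma cinf_ext (f g : cinf M) : f =1 g -> f = g.
Proof. by move=> fg; apply/val_inj/funext. Qed.

(* Tangent vectors at [p] are the derivations at [p] of C^oo(M). *)
Record tangent (p : M) := Tangent {
  tangent_fun :> cinf M -> R;
  tangent_scalar : scalar tangent_fun;
  tangent_leibniz : forall f g : cinf M,
    tangent_fun (f * g) = f p * tangent_fun g + g p * tangent_fun f
}.

Variable p : M.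
Implicit Types u v w : tangent p.

HB.instance Definition _ := gen_eqMixin (tangent p).
HB.instance Definition _ := gen_choiceMixin (tangent p).

Lemma tangent_ext u v : (u : cinf M -> R) =1 v -> u = v.
Proof.
case: u v => [u us ul] [v vs vl] /= /funext uv; subst v.
by congr Tangent; exact: Prop_irrelevance.
Qed.

Definition tangent_zero : tangent p.
Proof. by exists (fun=> 0) => [a f g|f g]; ring. Defined.

Definition tangent_opp u : tangent p.
Proof.
exists (fun f => - u f) => [a f g|f g].
  by rewrite tangent_scalar; ring.
by rewrite tangent_leibniz; ring.
Defined.

Definition tangent_add u v : tangent p.
Proof.
exists (fun f => u f + v f) => [a f g|f g].
  by rewrite !tangent_scalar; ring.
by rewrite !tangent_leibniz; ring.
Defined.

Definition tangent_scale (a : R) u : tangent p.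
Proof.
exists (fun f => a * u f) => [b f g|f g].
  by rewrite !tangent_scalar; ring.
by rewrite !tangent_leibniz; ring.
Defined.

Lemma tangent_addA : associative tangent_add.
Proof. by move=> u v w; apply: tangent_ext => f /=; ring. Qed.
Lemma tangent_addC : commutative tangent_add.
Proof. by move=> u v; apply: tangent_ext => f /=; ring. Qed.
Lemma tangent_add0 : left_id tangent_zero tangent_add.
Proof. by move=> u; apply: tangent_ext => f /=; ring. Qed.
Lemma tangent_addN : left_inverse tangent_zero tangent_opp tangent_add.
Proof. by move=> u; apply: tangent_ext => f /=; ring. Qed.

HB.instance Definition _ := GRing.isZmodule.Build (tangent p)
  tangent_addA tangent_addC tangent_add0 tangent_addN.

Lemma tangent_scaleA a b u :
  tangent_scale a (tangent_scale b u) = tangent_scale (a * b) u.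
Proof. by apply: tangent_ext => f /=; ring. Qed.
Lemma tangent_scale1 : left_id 1 tangent_scale.
Proof. by move=> u; apply: tangent_ext => f /=; ring. Qed.
Lemma tangent_scaleDr : right_distributive tangent_scale +%R.
Proof. by move=> a u v; apply: tangent_ext => f /=; ring. Qed.
Lemma tangent_scaleDl u : {morph tangent_scale^~ u : a b / a + b}.
Proof. by move=> a b; apply: tangent_ext => f /=; ring. Qed.

HB.instance Definition _ := GRing.Zmodule_isLmodule.Build R (tangent p)
  tangent_scaleA tangent_scale1 tangent_scaleDr tangent_scaleDl.
End tangent_vectors.

Section vector_fields.
Variables (R : realType) (n : nat) (M : smoothManifoldType R n).

(* Sections of TM; [X] is smooth iff X f is smooth for every smooth f. *)
Record vfield := VField {
  vfield_at :> forall p : M, tangent p;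
  vfield_smooth : forall f : cinf M, smooth_fun (fun p => vfield_at p f)
}.

Implicit Types (X Y Z : vfield) (f g h : cinf M).

HB.instance Definition _ := gen_eqMixin vfield.
HB.instance Definition _ := gen_choiceMixin vfield.

(* The smooth function X f, p |-> X_p f. *)
Definition vact X f : cinf M :=
  Cinf (introT (smooth_predP _) (@vfield_smooth X f)).

Lemma vfield_ext X Y : (forall f, vact X f = vact Y f) -> X = Y.
Proof.
move=> XY.
have {}XY : vfield_at X = vfield_at Y.
  apply: functional_extensionality_dep => p; apply: tangent_ext => f.
  exact: (congr1 (fun h : cinf M => h p) (XY f)).
case: X Y XY => [X Xs] [Y Ys] /= XY; subst Y.
by congr VField; exact: Prop_irrelevance.
Qed.

Lemma cinf_smooth f : smooth_fun f.
Proof. exact/smooth_predP/cinf_mem. Qed.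

Definition vfield_zero : vfield.
Proof. by exists (fun p => 0) => f; exact: smooth_cst. Defined.

Definition vfield_opp X : vfield.
Proof. by exists (fun p => - X p) => f; exact/smoothN/vfield_smooth. Defined.

Definition vfield_add X Y : vfield.
Proof.
exists (fun p => X p + Y p) => f.
exact: smoothD (vfield_smooth X f) (vfield_smooth Y f).
Defined.

Definition vfield_scale f X : vfield.
Proof.
exists (fun p => f p *: X p) => g.
exact: smoothM (cinf_smooth f) (vfield_smooth X g).
Defined.

Lemma vfield_addA : associative vfield_add.
Proof.
by move=> X Y Z; apply: vfield_ext => f; apply: cinf_ext => p; exact: addrA.
Qed.
Lemma vfield_addC : commutative vfield_add.
Proof.
by move=> X Y; apply: vfield_ext => f; apply: cinf_ext => p; exact: addrC.
Qed.
Lemma vfield_add0 : left_id vfield_zero vfield_add.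
Proof.
by move=> X; apply: vfield_ext => f; apply: cinf_ext => p; exact: add0r.
Qed.
Lemma vfield_addN : left_inverse vfield_zero vfield_opp vfield_add.
Proof.
by move=> X; apply: vfield_ext => f; apply: cinf_ext => p; exact: addNr.
Qed.

HB.instance Definition _ := GRing.isZmodule.Build vfield
  vfield_addA vfield_addC vfield_add0 vfield_addN.

Lemma vfield_scaleA f g X :
  vfield_scale f (vfield_scale g X) = vfield_scale (f * g) X.
Proof. by apply: vfield_ext => h; apply: cinf_ext => p; exact: mulrA. Qed.
Lemma vfield_scale1 : left_id 1 vfield_scale.
Proof.
by move=> X; apply: vfield_ext => f; apply: cinf_ext => p; exact: mul1r.
Qed.
Lemma vfield_scaleDr : right_distributive vfield_scale +%R.
Proof.
by move=> f X Y; apply: vfield_ext => h; apply: cinf_ext => p; exact: mulrDr.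
Qed.
Lemma vfield_scaleDl X : {morph vfield_scale^~ X : f g / f + g}.
Proof.
by move=> f g; apply: vfield_ext => h; apply: cinf_ext => p; exact: mulrDl.
Qed.

HB.instance Definition _ := GRing.Zmodule_isLmodule.Build (cinf M) vfield
  vfield_scaleA vfield_scale1 vfield_scaleDr vfield_scaleDl.

Lemma vact0l g : vact 0 g = 0.
Proof. exact: cinf_ext. Qed.
Lemma vactNl X g : vact (- X) g = - vact X g.
Proof. exact: cinf_ext. Qed.
Lemma vactDl X Y g : vact (X + Y) g = vact X g + vact Y g.
Proof. exact: cinf_ext. Qed.
Lemma vactZl f X g : vact (f *: X) g = f * vact X g.
Proof. exact: cinf_ext. Qed.
Lemma vactDr X f g : vact X (f + g) = vact X f + vact X g.
Proof.
by apply: cinf_ext => p; have := tangent_scalar (X p) 1 f g; rewrite scale1r mul1r.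
Qed.
Lemma vact0r X : vact X 0 = 0.
Proof. by apply: (addrI (vact X 0)); rewrite -vactDr !addr0. Qed.
Lemma vactNr X f : vact X (- f) = - vact X f.
Proof. by apply: (addrI (vact X f)); rewrite -vactDr !subrr vact0r. Qed.
Lemma vactMr X f g : vact X (f * g) = f * vact X g + g * vact X f.
Proof. by apply: cinf_ext => p; exact: tangent_leibniz. Qed.

Definition vactE :=
  (vact0l, vactNl, vactDl, vactZl, vact0r, vactNr, vactDr, vactMr).

Definition lie_at X Y (p : M) : tangent p.
Proof.
exists (fun f => X p (vact Y f) - Y p (vact X f)) => [a f g|f g].
  have vZ Z : vact Z (a *: f + g) = a *: vact Z f + vact Z g.
    by apply: cinf_ext => q; exact: tangent_scalar.
  by rewrite !vZ !tangent_scalar; ring.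
have XD h1 h2 : X p (h1 + h2) = X p h1 + X p h2.
  exact: (congr1 (fun h : cinf M => h p) (vactDr X h1 h2)).
have YD h1 h2 : Y p (h1 + h2) = Y p h1 + Y p h2.
  exact: (congr1 (fun h : cinf M => h p) (vactDr Y h1 h2)).
by rewrite !vactMr XD YD !tangent_leibniz /=; ring.
Defined.

Definition lie X Y : vfield.
Proof.
exists (lie_at X Y) => f.
exact: smoothD (vfield_smooth X (vact Y f)) (smoothN (vfield_smooth Y (vact X f))).
Defined.

Lemma vact_lie X Y f : vact (lie X Y) f = vact X (vact Y f) - vact Y (vact X f).
Proof. exact: cinf_ext. Qed.

Lemma lieNC X Y : lie Y X = - lie X Y.
Proof. by apply: vfield_ext => f; rewrite !(vact_lie, vactE); ring. Qed.

Lemma lieXX X : lie X X = 0.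
Proof. by apply: vfield_ext => f; rewrite !(vact_lie, vactE); ring. Qed.

Lemma lieDl X Y Z : lie (X + Y) Z = lie X Z + lie Y Z.
Proof. by apply: vfield_ext => f; rewrite !(vact_lie, vactE); ring. Qed.

Lemma lieZl f X Y : lie (f *: X) Y = f *: lie X Y - vact Y f *: X.
Proof. by apply: vfield_ext => g; rewrite !(vact_lie, vactE); ring. Qed.

Lemma lieDr X Y Z : lie X (Y + Z) = lie X Y + lie X Z.
Proof. by apply: vfield_ext => f; rewrite !(vact_lie, vactE); ring. Qed.

Lemma lieZr f X Y : lie X (f *: Y) = f *: lie X Y + vact X f *: Y.
Proof. by apply: vfield_ext => g; rewrite !(vact_lie, vactE); ring. Qed.
End vector_fields.

(* Differential k-forms are identified with alternating C^oo(M)-multilinear maps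
   X(M)^k -> C^oo(M) (tensor characterization lemma). *)
Notation form1 M := {scalar vfield M}.

Section forms.
Variables (R : realType) (n : nat) (M : smoothManifoldType R n).
Implicit Types (X Y Z W : vfield M) (f g : cinf M).

Record form2 := Form2 {
  form2_fun :> vfield M -> vfield M -> cinf M;
  form2_scalarl : forall Y, scalar (form2_fun^~ Y);
  form2_scalarr : forall X, scalar (form2_fun X);
  form2_alt : forall X, form2_fun X X = 0
}.

Record form3 := Form3 {
  form3_fun :> vfield M -> vfield M -> vfield M -> cinf M;
  form3_scalar1 : forall Y W, scalar (fun X => form3_fun X Y W);
  form3_scalar2 : forall X W, scalar (fun Y => form3_fun X Y W);
  form3_scalar3 : forall X Y, scalar (fun W => form3_fun X Y W);
  form3_alt12 : forall X Y, form3_fun X X Y = 0;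
  form3_alt23 : forall X Y, form3_fun X Y Y = 0;
  form3_alt13 : forall X Y, form3_fun X Y X = 0
}.

HB.instance Definition _ := gen_eqMixin form3.
HB.instance Definition _ := gen_choiceMixin form3.

Lemma form3_ext (a b : form3) : (forall X Y W, a X Y W = b X Y W) -> a = b.
Proof.
move=> ab; have {}ab : form3_fun a = form3_fun b.
  by apply/funext => X; apply/funext => Y; apply/funext => W.
case: a b ab => [a a1 a2 a3 a4 a5 a6] [b b1 b2 b3 b4 b5 b6] /= ab; subst b.
by congr Form3; exact: Prop_irrelevance.
Qed.

Definition form3_zero : form3.
Proof. by exists (fun _ _ _ => 0) => // X Y a Z W; ring. Defined.

Definition form3_opp (a : form3) : form3.
Proof.
exists (fun X Y W => - a X Y W).
- by move=> Y W f X X'; rewrite form3_scalar1; ring.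
- by move=> X W f Y Y'; rewrite form3_scalar2; ring.
- by move=> X Y f W W'; rewrite form3_scalar3; ring.
- by move=> X Y; rewrite form3_alt12 oppr0.
- by move=> X Y; rewrite form3_alt23 oppr0.
- by move=> X Y; rewrite form3_alt13 oppr0.
Defined.

Definition form3_add (a b : form3) : form3.
Proof.
exists (fun X Y W => a X Y W + b X Y W).
- by move=> Y W f X X'; rewrite !form3_scalar1; ring.
- by move=> X W f Y Y'; rewrite !form3_scalar2; ring.
- by move=> X Y f W W'; rewrite !form3_scalar3; ring.
- by move=> X Y; rewrite !form3_alt12 addr0.
- by move=> X Y; rewrite !form3_alt23 addr0.
- by move=> X Y; rewrite !form3_alt13 addr0.
Defined.

Lemma form3_addA : associative form3_add.
Proof. by move=> a b c; apply: form3_ext => X Y W /=; ring. Qed.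
Lemma form3_addC : commutative form3_add.
Proof. by move=> a b; apply: form3_ext => X Y W /=; ring. Qed.
Lemma form3_add0 : left_id form3_zero form3_add.
Proof. by move=> a; apply: form3_ext => X Y W /=; ring. Qed.
Lemma form3_addN : left_inverse form3_zero form3_opp form3_add.
Proof. by move=> a; apply: form3_ext => X Y W /=; ring. Qed.

HB.instance Definition _ := GRing.isZmodule.Build form3
  form3_addA form3_addC form3_add0 form3_addN.


Definition skew_form2 (B : vfield M -> vfield M -> cinf M)
  (Bl : forall Y, scalar (B^~ Y)) (Bs : forall X Y, B X Y = - B Y X)
  (Ba : forall X, B X X = 0) : form2.
Proof.
exists B => // X f Y Y'; rewrite Bs (Bl X f Y Y') !(Bs X); ring.
Defined.

Definition cyclic (G : vfield M -> vfield M -> vfield M -> cinf M) X Y W :=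
  G X Y W + G Y W X + G W X Y.

Lemma cyclic_rot G X Y W : cyclic G X Y W = cyclic G Y W X.
Proof. by rewrite /cyclic; ring. Qed.

Definition cyclic_form3 (G : vfield M -> vfield M -> vfield M -> cinf M)
  (Gl : forall Y W, scalar (fun X => cyclic G X Y W))
  (Ga : forall X Y, cyclic G X X Y = 0) : form3.
Proof.
exists (cyclic G) => //.
- by move=> X W f Y Y'; rewrite !(cyclic_rot G X); exact: Gl.
- by move=> X Y f W W'; rewrite -!(cyclic_rot G _ X Y); exact: Gl.
- by move=> X Y; rewrite cyclic_rot.
- by move=> X Y; rewrite -cyclic_rot.
Defined.
End forms.

Section exterior_derivative.
Variables (R : realType) (n : nat) (M : smoothManifoldType R n).
Implicit Types (X Y Z W : vfield M) (f g : cinf M).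

Lemma scalar_additive (h : vfield M -> cinf M) (hl : scalar h) X Y :
  h (X + Y) = h X + h Y.
Proof. by have := hl 1 X Y; rewrite scale1r mul1r. Qed.

Lemma scalar_scale (h : vfield M -> cinf M) (hl : scalar h) f X :
  h (f *: X) = f * h X.
Proof.
have h0 : h 0 = 0.
  by apply: (addrI (h 0)); rewrite -(scalar_additive hl) !addr0.
by have := hl f X 0; rewrite h0 !addr0.
Qed.

Lemma scalar_opp (h : vfield M -> cinf M) (hl : scalar h) X : h (- X) = - h X.
Proof. by rewrite -scaleN1r (scalar_scale hl) mulN1r. Qed.

Section rules.
Variable b : form2 M.
Lemma form2Dl X Y Z : b (X + Y) Z = b X Z + b Y Z.
Proof. exact: (scalar_additive (form2_scalarl b Z)). Qed.
Lemma form2Zl f X Y : b (f *: X) Y = f * b X Y.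
Proof. exact: (scalar_scale (form2_scalarl b Y)). Qed.
Lemma form2Nl X Y : b (- X) Y = - b X Y.
Proof. exact: (scalar_opp (form2_scalarl b Y)). Qed.
Lemma form2Dr X Y Z : b X (Y + Z) = b X Y + b X Z.
Proof. exact: (scalar_additive (form2_scalarr b X)). Qed.
Lemma form2Zr f X Y : b X (f *: Y) = f * b X Y.
Proof. exact: (scalar_scale (form2_scalarr b X)). Qed.
Lemma form2Nr X Y : b X (- Y) = - b X Y.
Proof. exact: (scalar_opp (form2_scalarr b X)). Qed.

Lemma form2_skew X Y : b X Y = - b Y X.
Proof.
apply/eqP; rewrite -addr_eq0; apply/eqP.
have := form2_alt b (X + Y).
by rewrite form2Dl !form2Dr !form2_alt add0r addr0.
Qed.
End rules.
Definition form2E := (form2Dl, form2Zl, form2Nl, form2Dr, form2Zr, form2Nr).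
Definition lieE := (@lieDl _ _ M, @lieZl _ _ M, @lieDr _ _ M, @lieZr _ _ M).

Definition ext_d_fun (b : form2 M) X Y W : cinf M :=
  cyclic (fun X Y W => vact X (b Y W) - b (lie X Y) W) X Y W.

Lemma ext_d_scalar (b : form2 M) Y W : scalar (fun X => ext_d_fun b X Y W).
Proof.
move=> f X X'; rewrite /ext_d_fun /cyclic !(lieE, form2E, vactE).
rewrite (form2_skew b W X); ring.
Qed.

Lemma ext_d_alt (b : form2 M) X Y : ext_d_fun b X X Y = 0.
Proof.
rewrite /ext_d_fun /cyclic lieXX form2_alt (lieNC X Y).
have b0 : b 0 Y = 0 by rewrite -(scale0r X) form2Zl mul0r.
rewrite b0 form2Nl (form2_skew b Y X) !vactE; ring.
Qed.

(* No factor 1/3 in the normalization. *)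
Definition ext_d (b : form2 M) : form3 M :=
  cyclic_form3 (@ext_d_scalar b) (@ext_d_alt b).
End exterior_derivative.

Section connections.
Variables (R : realType) (n : nat) (M : smoothManifoldType R n).
Implicit Types (X Y Z W : vfield M) (f g : cinf M).

(* A connection on TM. R-homogeneity in [Y] is the Leibniz rule for constant [f]. *)
Record connection := Connection {
  nabla :> vfield M -> vfield M -> vfield M;
  nabla_linearl : forall Y, linear (nabla^~ Y);
  nablaDr : forall X Y Z, nabla X (Y + Z) = nabla X Y + nabla X Z;
  nablaZr : forall X f Y, nabla X (f *: Y) = vact X f *: Y + f *: nabla X Y
}.

Variable D : connection.

Lemma nablaDl X Y Z : D (X + Y) Z = D X Z + D Y Z.
Proof. by have := nabla_linearl D Z 1 X Y; rewrite !scale1r. Qed.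
Lemma nabla0l Z : D 0 Z = 0.
Proof. by apply: (addrI (D 0 Z)); rewrite -nablaDl !addr0. Qed.
Lemma nablaZl f X Y : D (f *: X) Y = f *: D X Y.
Proof. by have := nabla_linearl D Y f X 0; rewrite nabla0l !addr0. Qed.
Lemma nablaNl X Y : D (- X) Y = - D X Y.
Proof. by rewrite -scaleN1r nablaZl scaleN1r. Qed.
Lemma nabla0r X : D X 0 = 0.
Proof. by apply: (addrI (D X 0)); rewrite -nablaDr !addr0. Qed.
Lemma nablaNr X Y : D X (- Y) = - D X Y.
Proof. by apply: (addrI (D X Y)); rewrite -nablaDr !subrr nabla0r. Qed.
Definition nablaE := (nablaDl, nablaZl, nablaNl, nablaDr, nablaZr, nablaNr).

Definition torsion X Y : vfield M := D X Y - D Y X - lie X Y.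

Definition curvature X Y Z : vfield M :=
  D X (D Y Z) - D Y (D X Z) - D (lie X Y) Z.

Lemma torsion_linear Y : linear (torsion^~ Y).
Proof.
move=> f X X'; apply: vfield_ext => g.
by rewrite /torsion !(lieE, nablaE) !(vactE, vact_lie); ring.
Qed.

Lemma torsion_skew X Y : torsion Y X = - torsion X Y.
Proof.
by apply: vfield_ext => g; rewrite /torsion (lieNC X) !vactE; ring.
Qed.

Lemma torsionXX X : torsion X X = 0.
Proof. by rewrite /torsion lieXX subrr subr0. Qed.

Lemma curvature_linear Y Z : linear (fun X => curvature X Y Z).
Proof.
move=> f X X'; apply: vfield_ext => g.
by rewrite /curvature !(lieE, nablaE) !vactE; ring.
Qed.

Lemma curvature_skew X Y Z : curvature Y X Z = - curvature X Y Z.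
Proof.
by apply: vfield_ext => g; rewrite /curvature (lieNC X) !nablaE !vactE; ring.
Qed.

Lemma curvatureXX X Z : curvature X X Z = 0.
Proof. by rewrite /curvature lieXX nabla0l subrr subr0. Qed.

Lemma curvature_linear3 X Y : linear (curvature X Y).
Proof.
move=> f Z Z'; apply: vfield_ext => g.
by rewrite /curvature !nablaE !(vactE, vact_lie); ring.
Qed.

Section one_form.
Variable theta : form1 M.

Lemma form1D X Y : theta (X + Y) = theta X + theta Y.
Proof. exact: raddfD. Qed.
Lemma form1N X : theta (- X) = - theta X.
Proof. exact: raddfN. Qed.
Lemma form1Z f X : theta (f *: X) = f * theta X.
Proof. exact: scalarZ. Qed.
Definition form1E := (form1D, form1N, form1Z).

(* (nabla_X theta)(Y) *)
Definition nabla_form X Y : cinf M := vact X (theta Y) - theta (D X Y).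

Lemma nabla_form_scalar X : scalar (nabla_form X).
Proof. by move=> f Y Y'; rewrite /nabla_form !(nablaE, form1E, vactE); ring. Qed.

Lemma nabla_form_scalarl Y : scalar (nabla_form^~ Y).
Proof. by move=> f X X'; rewrite /nabla_form !(nablaE, form1E, vactE); ring. Qed.

HB.instance Definition _ X :=
  GRing.isLinear.Build (cinf M) (vfield M) (cinf M) *%R (nabla_form X)
    (nabla_form_scalar X).

Lemma torsionDZ f X X' Y :
  torsion (f *: X + X') Y = f *: torsion X Y + torsion X' Y.
Proof. exact: torsion_linear. Qed.
Lemma curvatureDZ f X X' Y Z :
  curvature (f *: X + X') Y Z = f *: curvature X Y Z + curvature X' Y Z.
Proof. exact: curvature_linear. Qed.
Lemma curvatureDZ3 f X Y Z Z' :
  curvature X Y (f *: Z + Z') = f *: curvature X Y Z + curvature X Y Z'.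
Proof. exact: curvature_linear3. Qed.
Lemma curvatureDZ2 f X Y Y' Z :
  curvature X (f *: Y + Y') Z = f *: curvature X Y Z + curvature X Y' Z.
Proof.
rewrite curvature_skew curvatureDZ opprD -scalerN -!curvature_skew.
by rewrite (curvature_skew Y' X).
Qed.
Lemma torsionDZ2 f X Y Y' :
  torsion X (f *: Y + Y') = f *: torsion X Y + torsion X Y'.
Proof.
by rewrite torsion_skew torsionDZ opprD -scalerN -!torsion_skew.
Qed.
Lemma nablaDZ f X X' Y : D (f *: X + X') Y = f *: D X Y + D X' Y.
Proof. exact: nabla_linearl. Qed.
Lemma nabla_formE f X Y Y' :
  nabla_form X (f *: Y + Y') = f * nabla_form X Y + nabla_form X Y'.
Proof. exact: nabla_form_scalar. Qed.
Lemma nabla_formEl f X X' Y :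
  nabla_form (f *: X + X') Y = f * nabla_form X Y + nabla_form X' Y.
Proof. exact: nabla_form_scalarl. Qed.
Lemma nabla_formN X Y : nabla_form X (- Y) = - nabla_form X Y.
Proof. exact: (scalar_opp (nabla_form_scalar X)). Qed.
Lemma nabla_form0 X : nabla_form X 0 = 0.
Proof. by rewrite -(scale0r X) (scalar_scale (nabla_form_scalar X)) mul0r. Qed.
Lemma form10 : theta 0 = 0.
Proof. exact: raddf0. Qed.
Lemma form1DZ f X X' : theta (f *: X + X') = f * theta X + theta X'.
Proof. exact: scalarP. Qed.

(* [form1DZ] rather than [form1D], which would see through [torsion] and
   [curvature]. *)
Definition multiE := (torsionDZ, torsionDZ2, curvatureDZ, curvatureDZ2,
  curvatureDZ3, nablaDZ, nabla_formE, nabla_formEl, form1DZ).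

Definition torsion_form : form2 M.
Proof.
apply: (@skew_form2 _ _ _ (fun X Y => theta (torsion X Y))).
- by move=> Y f X X'; rewrite !multiE.
- by move=> X Y; rewrite torsion_skew form1N.
- by move=> X; rewrite torsionXX form10.
Defined.

Definition Xi_form : form2 M.
Proof.
apply: (@skew_form2 _ _ _ (fun X Y => nabla_form Y X - nabla_form X Y)).
- by move=> Y f X X'; rewrite !multiE; ring.
- by move=> X Y; ring.
- by move=> X; rewrite subrr.
Defined.

Definition curvature_form (Z : vfield M) : form2 M.
Proof.
apply: (@skew_form2 _ _ _ (fun X Y => theta (curvature X Y Z))).
- by move=> Y f X X'; rewrite !multiE.
- by move=> X Y; rewrite curvature_skew form1N.
- by move=> X; rewrite curvatureXX form10.
Defined.

Definition Psi_form (Z : vfield M) : form2 M.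
Proof.
apply: (@skew_form2 _ _ _
  (fun X Y => nabla_form Y (D X Z) - nabla_form X (D Y Z))).
- by move=> Y f X X'; rewrite !multiE; ring.
- by move=> X Y; ring.
- by move=> X; rewrite subrr.
Defined.

(* The 3-forms R_theta, (nabla theta) /\ T, (nabla theta) /\ R_Z and
   R_theta /\ (nabla Z), in this order. *)
Definition curvature_cyclic : form3 M.
Proof.
apply: (@cyclic_form3 _ _ _ (fun X Y W => theta (curvature X Y W))).
- by move=> Y W f X X'; rewrite /cyclic !multiE; ring.
- move=> X Y; rewrite /cyclic curvatureXX form10 (curvature_skew X Y) form1N.
  by ring.
Defined.

Definition nabla_wedge_torsion : form3 M.
Proof.
apply: (@cyclic_form3 _ _ _ (fun X Y W => nabla_form X (torsion Y W))).
- by move=> Y W f X X'; rewrite /cyclic !multiE; ring.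
- move=> X Y; rewrite /cyclic torsionXX nabla_form0 (torsion_skew X Y).
  by rewrite nabla_formN; ring.
Defined.

Definition nabla_wedge_curvature (Z : vfield M) : form3 M.
Proof.
apply: (@cyclic_form3 _ _ _ (fun X Y W => nabla_form X (curvature Y W Z))).
- by move=> Y W f X X'; rewrite /cyclic !multiE; ring.
- move=> X Y; rewrite /cyclic curvatureXX nabla_form0 (curvature_skew X Y).
  by rewrite nabla_formN; ring.
Defined.

Definition curvature_wedge_nabla (Z : vfield M) : form3 M.
Proof.
apply: (@cyclic_form3 _ _ _ (fun X Y W => theta (curvature Y W (D X Z)))).
- by move=> Y W f X X'; rewrite /cyclic !multiE; ring.
- move=> X Y; rewrite /cyclic curvatureXX form10 (curvature_skew X Y) form1N.
  by ring.
Defined.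
End one_form.
End connections.

(* Main.v *)
(** On vector fields alone, writing S for the cyclic sum over (X,Y,W), the
    definitions of T and R and the Jacobi identity give the Bianchi identities
      S (nabla_X T(Y,W) - T([X,Y],W)) = S R(X,Y)W,
      S (nabla_X (R(Y,W)Z) - R([X,Y],W)Z) = S R(Y,W)(nabla_X Z);
    applying [theta] and the Leibniz rule X(theta V) = (nabla_X theta)V +
    theta(nabla_X V) computes the differentials of T_theta and R_{theta,Z}.
    Moreover Xi_theta = T_theta - d theta and
    Psi_{theta,Z} = R_{theta,Z} - d(theta o nabla Z), so passing to Xi and Psi
    does not change the differentials. *)
Require Import Defs.
From mathcomp Require Import all_boot all_order all_algebra.
From mathcomp Require Import all_classical all_reals all_analysis.
From mathcomp Require Import ring.
Import GRing.Theory.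
Local Open Scope classical_set_scope.
Local Open Scope ring_scope.

Section differential.
Context {R : realType} {n : nat} {M : smoothManifoldType R n}.
Implicit Types (X Y W : vfield M).

Lemma lie_jacobi X Y W :
  lie (lie X Y) W + lie (lie Y W) X + lie (lie W X) Y = 0.
Proof. by apply: vfield_ext => f; rewrite !(vact_lie, vactE); ring. Qed.

(** The parenthesized term is the exterior derivative of [a], and d(da) = 0: second derivatives
    cancel because a bracket acts as a commutator, and what remains is [a] evaluated on the Jacobi
    sum. *)
Lemma ext_d_eq_mod_exact (b c : form2 M) (a : vfield M -> cinf M) :
  scalar a ->
  (forall X Y, b X Y = c X Y + (vact X (a Y) - vact Y (a X) - a (lie X Y))) ->
  ext_d b = ext_d c.
Proof.
move=> a_scalar bc; apply: form3_ext => X Y W.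
have aD := scalar_additive a_scalar.
have a0 : a 0 = 0 by apply: (addrI (a 0)); rewrite -aD !addr0.
have jac : a (lie (lie X Y) W) + a (lie (lie Y W) X) + a (lie (lie W X) Y) = 0.
  by rewrite -!aD lie_jacobi.
change (ext_d_fun b X Y W = ext_d_fun c X Y W).
rewrite /ext_d_fun /cyclic !bc !(vact_lie, vactE).
by rewrite -[RHS]addr0 -jac; ring.
Qed.
End differential.

Section bianchi.
Context {R : realType} {n : nat} {M : smoothManifoldType R n}.
Variable D : connection M.
Implicit Types (X Y Z W : vfield M).

(** The terms nabla_X [Y,W] cancel in pairs under the cyclic sum, and double covariant derivatives
    regroup into curvatures. The leftover double brackets vanish once [vact_lie] turns them into
    commutators. *)
Lemma bianchi_torsion X Y W :
  (D X (torsion D Y W) - torsion D (lie X Y) W)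
  + (D Y (torsion D W X) - torsion D (lie Y W) X)
  + (D W (torsion D X Y) - torsion D (lie W X) Y)
  = curvature D X Y W + curvature D Y W X + curvature D W X Y.
Proof.
apply: vfield_ext => f.
by rewrite /torsion /curvature !nablaE !(vact_lie, vactE); ring.
Qed.

Lemma bianchi_curvature X Y W Z :
  (D X (curvature D Y W Z) - curvature D (lie X Y) W Z)
  + (D Y (curvature D W X Z) - curvature D (lie Y W) X Z)
  + (D W (curvature D X Y Z) - curvature D (lie W X) Y Z)
  = curvature D Y W (D X Z) + curvature D W X (D Y Z) + curvature D X Y (D W Z).
Proof.
(* Here double brackets occur only as directions of differentiation, which [ring] treats as atoms,
   so the Jacobi identity is supplied by hand. *)
have jac : D (lie (lie X Y) W) Z + D (lie (lie Y W) X) Z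
    + D (lie (lie W X) Y) Z = 0.
  by rewrite -!nablaDl lie_jacobi nabla0l.
apply: vfield_ext => f; rewrite /curvature !nablaE !vactE.
have := congr1 (fun V => vact V f) jac; rewrite /= !vactE => jacf.
by rewrite -[RHS]addr0 -jacf; ring.
Qed.

Variable theta : form1 M.

Lemma vact_form1 X Y :
  vact X (theta Y) = nabla_form D theta X Y + theta (D X Y).
Proof. by rewrite /nabla_form subrK. Qed.

(** Common core of (I) and (II): [B] will be the torsion or the curvature applied to a fixed [Z],
    and [C] the summand on the right of its Bianchi identity. *)
Lemma ext_d_comp_form1 (b : form2 M) (B : vfield M -> vfield M -> vfield M)
    (C : vfield M -> vfield M -> vfield M -> vfield M) X Y W :
  (forall U V, b U V = theta (B U V)) ->
  (D X (B Y W) - B (lie X Y) W) + (D Y (B W X) - B (lie Y W) X)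
    + (D W (B X Y) - B (lie W X) Y) = C X Y W + C Y W X + C W X Y ->
  ext_d b X Y W = cyclic (fun X Y W => nabla_form D theta X (B Y W)) X Y W
    + cyclic (fun X Y W => theta (C X Y W)) X Y W.
Proof.
move=> bE /(congr1 theta); rewrite !form1E => BC.
change (ext_d b X Y W) with (ext_d_fun b X Y W).
rewrite /ext_d_fun /cyclic !bE !vact_form1.
by rewrite -BC; ring.
Qed.

Lemma ext_d_torsion_form :
  ext_d (torsion_form D theta)
  = curvature_cyclic D theta + nabla_wedge_torsion D theta.
Proof.
apply: form3_ext => X Y W.
rewrite (ext_d_comp_form1 _ (torsion D) (curvature D)) //; first exact: addrC.
exact: bianchi_torsion.
Qed.

Lemma ext_d_curvature_form Z :
  ext_d (curvature_form D theta Z)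
  = nabla_wedge_curvature D theta Z + curvature_wedge_nabla D theta Z.
Proof.
apply: form3_ext => X Y W.
rewrite (ext_d_comp_form1 _ (fun X Y => curvature D X Y Z)
  (fun X Y W => curvature D Y W (D X Z))) //.
exact: bianchi_curvature.
Qed.

Lemma ext_d_Xi_form : ext_d (torsion_form D theta) = ext_d (Xi_form D theta).
Proof.
apply: (ext_d_eq_mod_exact _ _ theta) => [|X Y]; first exact: scalarP.
rewrite /= /nabla_form /torsion !form1E; ring.
Qed.

Lemma ext_d_Psi_form Z :
  ext_d (curvature_form D theta Z) = ext_d (Psi_form D theta Z).
Proof.
apply: (ext_d_eq_mod_exact _ _ (fun X => theta (D X Z))) => [f X X'|X Y].
  by rewrite !nablaE !form1E.
rewrite /= /nabla_form /curvature !form1E; ring.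
Qed.
End bianchi.

Theorem corollary2p9 (R : realType) (n : nat) (M : smoothManifoldType R n)
    (M_connected : connected [set: M]) (D : connection M)
    (theta : form1 M) (Z : vfield M) :
  (ext_d (torsion_form D theta) = ext_d (Xi_form D theta) /\
   ext_d (Xi_form D theta)
     = curvature_cyclic D theta + nabla_wedge_torsion D theta) /\
  (ext_d (curvature_form D theta Z) = ext_d (Psi_form D theta Z) /\
   ext_d (Psi_form D theta Z)
     = nabla_wedge_curvature D theta Z + curvature_wedge_nabla D theta Z).
Proof.
rewrite -ext_d_Xi_form -ext_d_Psi_form.
by rewrite ext_d_torsion_form ext_d_curvature_form.
Qed.
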